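(* Let $(n_k)$ be a strictly increasing sequence of positive integers such that $n_k$ divides $n_{k+1}$ for every $k$. Suppose that $n_j/n_{j-1}\ge6$ for infinitely many indices $j$. Then there is a normal contraction $T$ on $\ell^2$ such that $$\sigma(T)\cap\mathbb T=\{1\},\qquad\sup_k\|I-T^{n_k}\|=1,$$ but $T$ is not a Ritt operator. In particular, this conclusion holds for every divisibility chain (a strictly increasing sequence of positive integers with $n_k\mid n_{k+1}$ for all $k$) with unbounded successive quotients.
   Context: $\mathbb D$ is the open unit disc, $\mathbb T$ the unit circle. A bounded operator $T$ is a Ritt operator if $\sigma(T)\subset\overline{\mathbb D}$ and $\sup_{|\lambda|>1}|\lambda-1|\,\|(\lambda-T)^{-1}\|<\infty$. $\ell^2$ is the complex Hilbert space of square-summable sequences. *)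

(* Defs.v *)
From Stdlib Require Import Reals Lra Lia.
From Stdlib Require Import FunctionalExtensionality ProofIrrelevance.
From Coquelicot Require Import Coquelicot.

Open Scope R_scope.

Definition square_summable (u : nat -> C) : Prop :=
  ex_series (fun n => Cmod (u n) ^ 2).

Definition l2 : Type := {u : nat -> C | square_summable u}.

Definition l2_seq (x : l2) : nat -> C := proj1_sig x.
Coercion l2_seq : l2 >-> Funclass.

Lemma l2_summable (x : l2) : ex_series (fun n => Cmod (x n) ^ 2).
Proof. exact (proj2_sig x). Qed.

Lemma l2_ext (x y : l2) : (forall n, x n = y n) -> x = y.
Proof.
  destruct x as [u hu], y as [v hv]; unfold l2_seq; simpl; intros H.
  assert (E : u = v) by (apply functional_extensionality; exact H).
  subst v. f_equal. apply proof_irrelevance.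
Qed.

Lemma Cmod_plus_sqr_le (t : R) (a b : C) : 0 < t ->
  Cmod (a + b)%C ^ 2 <= (1 + t) * Cmod a ^ 2 + (1 + / t) * Cmod b ^ 2.
Proof.
  intros ht.
  assert (H1 := Cmod_triangle a b). assert (H0 := Cmod_ge_0 (a + b)%C).
  set (p := Cmod a) in *; set (q := Cmod b) in *.
  apply Rle_trans with ((p + q) ^ 2); [apply pow_incr; lra|].
  assert (E : (1 + t) * p ^ 2 + (1 + / t) * q ^ 2 - (p + q) ^ 2
              = / t * (t * p - q) ^ 2) by (field; lra).
  assert (0 <= / t * (t * p - q) ^ 2).
  { apply Rmult_le_pos; [left; apply Rinv_0_lt_compat; lra | apply pow2_ge_0]. }
  lra.
Qed.

Lemma square_summable_plus (u v : nat -> C) :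
  square_summable u -> square_summable v ->
  square_summable (fun n => (u n + v n)%C).
Proof.
  intros hu hv. unfold square_summable in *.
  apply (ex_series_le (K := R_AbsRing) (V := R_CompleteNormedModule)) with
    (fun n => (1 + 1) * Cmod (u n) ^ 2 + (1 + / 1) * Cmod (v n) ^ 2).
  - intros n. change (Rabs (Cmod (u n + v n)%C ^ 2) <=
      (1 + 1) * Cmod (u n) ^ 2 + (1 + / 1) * Cmod (v n) ^ 2).
    rewrite Rabs_pos_eq by apply pow2_ge_0.
    apply Cmod_plus_sqr_le; lra.
  - apply (ex_series_plus (V := R_NormedModule)).
    + exact (ex_series_scal (V := R_NormedModule) (1 + 1) _ hu).
    + exact (ex_series_scal (V := R_NormedModule) (1 + / 1) _ hv).
Qed.

Lemma square_summable_scal (c : C) (u : nat -> C) :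
  square_summable u -> square_summable (fun n => (c * u n)%C).
Proof.
  intros hu. unfold square_summable in *.
  apply ex_series_ext with (fun n => Cmod c ^ 2 * Cmod (u n) ^ 2).
  - intros n. rewrite Cmod_mult. symmetry. apply Rpow_mult_distr.
  - exact (ex_series_scal (V := R_NormedModule) (Cmod c ^ 2) _ hu).
Qed.

Lemma square_summable_0 : square_summable (fun _ => RtoC 0).
Proof.
  exists 0.
  change (is_lim_seq (sum_n (fun _ => Cmod (RtoC 0) ^ 2)) 0).
  apply is_lim_seq_ext with (fun _ => 0).
  - intros n. rewrite sum_n_const, Cmod_0. ring.
  - apply is_lim_seq_const.
Qed.

Definition l2_plus (x y : l2) : l2 :=
  exist _ _ (square_summable_plus _ _ (l2_summable x) (l2_summable y)).
Definition l2_scal (c : C) (x : l2) : l2 :=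
  exist _ _ (square_summable_scal c _ (l2_summable x)).
Definition l2_zero : l2 := exist _ _ square_summable_0.
Definition l2_opp (x : l2) : l2 := l2_scal (RtoC (-1)) x.

Definition l2_norm (x : l2) : R := sqrt (Series (fun n => Cmod (x n) ^ 2)).

Lemma l2_plus_comm x y : l2_plus x y = l2_plus y x.
Proof. apply l2_ext; intros n; apply Cplus_comm. Qed.
Lemma l2_plus_assoc x y z :
  l2_plus x (l2_plus y z) = l2_plus (l2_plus x y) z.
Proof. apply l2_ext; intros n; apply Cplus_assoc. Qed.
Lemma l2_plus_zero_r x : l2_plus x l2_zero = x.
Proof. apply l2_ext; intros n; apply Cplus_0_r. Qed.
Lemma l2_plus_opp_r x : l2_plus x (l2_opp x) = l2_zero.
Proof. apply l2_ext; intros n.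
  change ((x n + RtoC (-1) * x n)%C = RtoC 0). ring.
Qed.
Lemma l2_scal_assoc a b x : l2_scal a (l2_scal b x) = l2_scal (a * b)%C x.
Proof. apply l2_ext; intros n; apply Cmult_assoc. Qed.
Lemma l2_scal_one x : l2_scal (RtoC 1) x = x.
Proof. apply l2_ext; intros n; apply Cmult_1_l. Qed.
Lemma l2_scal_distr_l a x y :
  l2_scal a (l2_plus x y) = l2_plus (l2_scal a x) (l2_scal a y).
Proof. apply l2_ext; intros n; apply Cmult_plus_distr_l. Qed.
Lemma l2_scal_distr_r a b x :
  l2_scal (a + b)%C x = l2_plus (l2_scal a x) (l2_scal b x).
Proof. apply l2_ext; intros n; apply Cmult_plus_distr_r. Qed.

Lemma l2_norm_ge_0 x : 0 <= l2_norm x.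
Proof. apply sqrt_pos. Qed.

Lemma l2_series_ge_0 (x : l2) : 0 <= Series (fun n => Cmod (x n) ^ 2).
Proof.
  rewrite <- (Rmult_0_l (Series (fun n => Cmod (x n) ^ 2))), <- Series_scal_l.
  apply Series_le; [|apply l2_summable].
  intros n; assert (H := pow2_ge_0 (Cmod (x n))); lra.
Qed.

Lemma l2_norm_sqr x : l2_norm x ^ 2 = Series (fun n => Cmod (x n) ^ 2).
Proof. apply pow2_sqrt, l2_series_ge_0. Qed.

Lemma Cmod_le_l2_norm (x : l2) (n : nat) : Cmod (x n) <= l2_norm x.
Proof.
  apply Rsqr_incr_0; [|apply Cmod_ge_0|apply l2_norm_ge_0].
  rewrite !Rsqr_pow2, l2_norm_sqr.
  rewrite (Series_incr_n _ (S n)); [|lia|apply l2_summable].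
  assert (H : 0 <= Series (fun k => Cmod (x (S n + k)%nat) ^ 2)).
  { rewrite <- (Rmult_0_l (Series (fun k => Cmod (x (S n + k)%nat) ^ 2))),
      <- Series_scal_l.
    apply Series_le.
    - intros k; assert (H := pow2_ge_0 (Cmod (x (S n + k)%nat))); lra.
    - exact (proj1 (ex_series_incr_n _ (S n)) (l2_summable x)). }
  assert (H' : Cmod (x n) ^ 2 <=
               sum_f_R0 (fun k => Cmod (x k) ^ 2) (pred (S n))).
  { simpl pred. destruct n as [|n]; [simpl; lra|].
    rewrite tech5.
    assert (0 <= sum_f_R0 (fun k => Cmod (x k) ^ 2) n)
      by (apply cond_pos_sum; intros k; apply pow2_ge_0).
    lra. }
  lra.
Qed.

Lemma l2_norm_eq_0 x : l2_norm x = 0 -> x = l2_zero.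
Proof.
  intros H. apply l2_ext; intros n. apply Cmod_eq_0.
  assert (H1 := Cmod_le_l2_norm x n). assert (H2 := Cmod_ge_0 (x n)). lra.
Qed.

Lemma l2_norm_zero : l2_norm l2_zero = 0.
Proof.
  unfold l2_norm.
  rewrite (Series_ext _ (fun n => 0 * Cmod (l2_zero n) ^ 2)).
  - rewrite Series_scal_l, Rmult_0_l. apply sqrt_0.
  - intros n. cbn [l2_zero l2_seq proj1_sig]. rewrite Cmod_0. ring.
Qed.

Lemma l2_norm_triangle x y : l2_norm (l2_plus x y) <= l2_norm x + l2_norm y.
Proof.
  destruct (Req_dec (l2_norm x) 0) as [hx|hx].
  { rewrite (l2_norm_eq_0 x hx), l2_plus_comm, l2_plus_zero_r, l2_norm_zero.
    lra. }
  destruct (Req_dec (l2_norm y) 0) as [hy|hy].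
  { rewrite (l2_norm_eq_0 y hy), l2_plus_zero_r, l2_norm_zero. lra. }
  assert (px := l2_norm_ge_0 x). assert (py := l2_norm_ge_0 y).
  assert (ht : 0 < l2_norm y / l2_norm x) by (apply Rdiv_lt_0_compat; lra).
  set (t := l2_norm y / l2_norm x) in *.
  apply Rsqr_incr_0; [|apply l2_norm_ge_0|lra].
  rewrite !Rsqr_pow2.
  apply Rle_trans with ((1 + t) * l2_norm x ^ 2 + (1 + / t) * l2_norm y ^ 2).
  - rewrite !l2_norm_sqr, <- !Series_scal_l, <- Series_plus;
      [|exact (ex_series_scal (V := R_NormedModule) (1 + t) _ (l2_summable x))
       |exact (ex_series_scal (V := R_NormedModule) (1 + / t) _
                 (l2_summable y))].
    apply Series_le.
    + intros n. split; [apply pow2_ge_0 | apply Cmod_plus_sqr_le; exact ht].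
    + apply (ex_series_plus (V := R_NormedModule)).
      * exact (ex_series_scal (V := R_NormedModule) (1 + t) _ (l2_summable x)).
      * exact (ex_series_scal (V := R_NormedModule) (1 + / t) _
                 (l2_summable y)).
  - right. unfold t. field. lra.
Qed.

Lemma l2_norm_scal c x : l2_norm (l2_scal c x) = Cmod c * l2_norm x.
Proof.
  unfold l2_norm.
  rewrite (Series_ext _ (fun n => Cmod c ^ 2 * Cmod (x n) ^ 2)).
  - rewrite Series_scal_l, sqrt_mult;
      [|apply pow2_ge_0|apply l2_series_ge_0].
    rewrite sqrt_pow2 by apply Cmod_ge_0. reflexivity.
  - intros n. cbn [l2_scal l2_seq proj1_sig]. rewrite Cmod_mult. apply Rpow_mult_distr.
Qed.

Definition l2_AbelianMonoid_mixin :=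
  AbelianMonoid.Mixin l2 l2_plus l2_zero
    l2_plus_comm l2_plus_assoc l2_plus_zero_r.
Canonical l2_AbelianMonoid :=
  AbelianMonoid.Pack l2 l2_AbelianMonoid_mixin l2.

Definition l2_AbelianGroup_mixin :=
  AbelianGroup.Mixin l2_AbelianMonoid l2_opp l2_plus_opp_r.
Canonical l2_AbelianGroup :=
  AbelianGroup.Pack l2
    (AbelianGroup.Class _ l2_AbelianMonoid_mixin l2_AbelianGroup_mixin) l2.

Definition l2_ModuleSpace_mixin :=
  ModuleSpace.Mixin C_Ring l2_AbelianGroup l2_scal
    l2_scal_assoc l2_scal_one l2_scal_distr_l l2_scal_distr_r.
Canonical l2_ModuleSpace :=
  ModuleSpace.Pack C_Ring l2
    (ModuleSpace.Class C_Ring l2 (AbelianGroup.class l2_AbelianGroup)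
       l2_ModuleSpace_mixin) l2.

Definition l2_ball (x : l2) (e : R) (y : l2) : Prop :=
  l2_norm (minus y x) < e.

Lemma l2_ball_center (x : l2) (e : posreal) : l2_ball x e x.
Proof.
  unfold l2_ball. rewrite minus_eq_zero.
  change (l2_norm l2_zero < e). rewrite l2_norm_zero. apply cond_pos.
Qed.

Lemma l2_ball_sym (x y : l2) (e : R) : l2_ball x e y -> l2_ball y e x.
Proof.
  unfold l2_ball. intros H.
  rewrite <- (opp_minus y x).
  change (l2_norm (l2_scal (RtoC (-1)) (minus y x)) < e).
  rewrite l2_norm_scal, Cmod_R, Rabs_left by lra. lra.
Qed.

Lemma l2_ball_triangle (x y z : l2) (e1 e2 : R) :
  l2_ball x e1 y -> l2_ball y e2 z -> l2_ball x (e1 + e2) z.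
Proof.
  unfold l2_ball. intros H1 H2.
  rewrite (minus_trans y z x).
  apply Rle_lt_trans with (1 := l2_norm_triangle (minus z y) (minus y x)). lra.
Qed.

Definition l2_UniformSpace_mixin :=
  UniformSpace.Mixin l2 l2_zero l2_ball
    l2_ball_center l2_ball_sym l2_ball_triangle.
Canonical l2_UniformSpace := UniformSpace.Pack l2 l2_UniformSpace_mixin l2.

Canonical l2_NormedModuleAux :=
  NormedModuleAux.Pack C_AbsRing l2
    (NormedModuleAux.Class C_AbsRing l2 (ModuleSpace.class _ l2_ModuleSpace)
       l2_UniformSpace_mixin) l2.

Lemma l2_norm_scal_le (c : C_AbsRing) (x : l2) :
  l2_norm (scal c x) <= abs c * l2_norm x.
Proof. right. apply l2_norm_scal. Qed.

Lemma l2_ball_norm (x y : l2) (e : posreal) :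
  ball x e y -> l2_norm (minus y x) < 1 * e.
Proof. rewrite Rmult_1_l. exact (fun H => H). Qed.

Definition l2_NormedModule_mixin :=
  NormedModule.Mixin C_AbsRing l2_NormedModuleAux l2_norm 1
    l2_norm_triangle l2_norm_scal_le (fun x y e H => H) l2_ball_norm
    l2_norm_eq_0.
Canonical l2_NormedModule :=
  NormedModule.Pack C_AbsRing l2
    (NormedModule.Class C_AbsRing l2
       (NormedModuleAux.class _ l2_NormedModuleAux)
       l2_NormedModule_mixin) l2.

(** [Series] is only defined for real series, hence the split into real and
    imaginary parts; both series converge by [ex_series_l2_inner]. *)
Definition l2_inner (x y : l2) : C :=
  (Series (fun n => Re (x n * Cconj (y n))%C),
   Series (fun n => Im (x n * Cconj (y n))%C)).

Lemma ex_series_l2_inner (x y : l2) :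
  ex_series (fun n => Re (x n * Cconj (y n))%C) /\
  ex_series (fun n => Im (x n * Cconj (y n))%C).
Proof.
  assert (HB : ex_series (fun n => Cmod (x n) ^ 2 + Cmod (y n) ^ 2))
    by exact (ex_series_plus (V := R_NormedModule) _ _
                (l2_summable x) (l2_summable y)).
  assert (HM : forall n, Cmod (x n * Cconj (y n))%C <=
                         Cmod (x n) ^ 2 + Cmod (y n) ^ 2).
  { intros n. rewrite Cmod_mult, Cmod_conj.
    assert (H := pow2_ge_0 (Cmod (x n) - Cmod (y n))).
    assert (H1 := pow2_ge_0 (Cmod (x n))). assert (H2 := pow2_ge_0 (Cmod (y n))).
    lra. }
  assert (HR : forall z : C, Rabs (Re z) <= Cmod z /\ Rabs (Im z) <= Cmod z).
  { intros z. assert (H := Rmax_Cmod z).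
    split; [exact (Rle_trans _ _ _ (Rmax_l _ _) H)
           |exact (Rle_trans _ _ _ (Rmax_r _ _) H)]. }
  split;
    apply (ex_series_le (K := R_AbsRing) (V := R_CompleteNormedModule)) with
      (2 := HB); intros n;
    [ exact (Rle_trans _ _ _ (proj1 (HR _)) (HM n))
    | exact (Rle_trans _ _ _ (proj2 (HR _)) (HM n)) ].
Qed.

Lemma l2_inner_self (x : l2) : l2_inner x x = RtoC (norm x ^ 2).
Proof.
  change (norm x) with (l2_norm x). rewrite l2_norm_sqr.
  unfold l2_inner, RtoC. f_equal.
  - apply Series_ext. intros n. rewrite <- Cmod2_conj. reflexivity.
  - rewrite (Series_ext _ (fun n => 0 * 0)).
    + rewrite Series_scal_l. ring.
    + intros n. rewrite <- Cmod2_conj. simpl. ring.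
Qed.

(** Coquelicot's [is_linear] contains boundedness, so a bounded operator is a
    map [T] with [is_linear T]. *)

Section Operators.

Context {X : NormedModule C_AbsRing}.

(** For a bounded [T] the supremum is finite and [real] loses nothing. *)
Definition op_norm (T : X -> X) : R :=
  real (Lub_Rbar (fun r => exists x : X, norm x <= 1 /\ r = norm (T x))).

Definition contraction (T : X -> X) : Prop := is_linear T /\ op_norm T <= 1.

(** [S] is [(z - T)^-1], as a bounded operator. *)
Definition is_resolvent (T : X -> X) (z : C) (S : X -> X) : Prop :=
  is_linear S /\
  (forall x, S (minus (scal z x) (T x)) = x) /\
  (forall x, minus (scal z (S x)) (T (S x)) = x).

Definition spectrum (T : X -> X) (z : C) : Prop :=
  ~ exists S, is_resolvent T z S.

(** The resolvent exists for [1 < Cmod z] by the second clause and is unique,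
    so quantifying over [S] amounts to naming it. *)
Definition ritt (T : X -> X) : Prop :=
  is_linear T /\
  (forall z, spectrum T z -> Cmod z <= 1) /\
  exists M : R, forall (z : C) (S : X -> X),
    1 < Cmod z -> is_resolvent T z S -> Cmod (z - 1)%C * op_norm S <= M.

Definition op_pow (T : X -> X) (n : nat) : X -> X := Nat.iter n T.

End Operators.

Definition is_adjoint (T S : l2 -> l2) : Prop :=
  is_linear S /\ forall x y, l2_inner (T x) y = l2_inner x (S y).

Definition normal (T : l2 -> l2) : Prop :=
  is_linear T /\
  exists S, is_adjoint T S /\ forall x, S (T x) = T (S x).

Definition divisibility_chain (n : nat -> nat) : Prop :=
  (forall k, (0 < n k)%nat) /\
  (forall k, (n k < n (S k))%nat) /\
  (forall k, Nat.divide (n k) (n (S k))).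

Definition quotient (n : nat -> nat) (j : nat) : R :=
  INR (n (S j)) / INR (n j).

(* Main.v *)
Require Import Defs.
From Stdlib Require Import Reals.
From Coquelicot Require Import Coquelicot.
From Stdlib Require Import Lra Lia Classical FunctionalExtensionality.
Open Scope R_scope.

(** The operator is diagonal, and everything is read off its eigenvalues.  A
    diagonal operator is normal, its norm is the supremum of the moduli of its
    entries ([diag_op_norm_le], [diag_op_norm_ge]), its powers and resolvents
    are diagonal, and its spectrum is the closure of the set of its entries
    ([diag_spectrum]).  So it suffices to find points [w] of the open disc,
    accumulating on the unit circle at [1] only, with [|1 - w^(n k)| <= 1] for
    all [k], and along which [|1 - w| / (1 - |w|)] is unbounded; the last
    property contradicts the Ritt resolvent estimate.

    Whenever [n (S j) / n j >= 6], put [t = 2 pi / n (S j)] and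
    [w = cos t e^(i t) = (1 + e^(2 i t)) / 2].  Divisibility and the constant
    [6] enter only through the angles [n k * t] ([cos_chain_angle]).  For
    [k > j], [n k] is a multiple of [n (S j)], so that [n k * t] is a multiple
    of [2 pi].  For [k <= j], [n k * t <= n j * t <= 2 pi / 6 = pi / 3].  Either
    way [cos (n k * t) >= 1/2], and every point [r e^(i s)] with [0 <= r <= 1]
    and [cos s >= 1/2] satisfies
    [|1 - r e^(i s)|^2 = 1 - 2 r cos s + r^2 <= 1]
    ([Cmod_one_minus_polar_le]), whatever the modulus [r] is.

    The modulus is therefore free, and [cos t] is a convenient choice: the
    points [w] lie on a circle internally tangent to the unit circle at [1], so
    [|1 - w| = sin t] is of order [t] while [1 - |w| = 1 - cos t] is of order
    [t^2].  As [j] grows, [t] tends to [0]: the points tend to [1] and the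
    quotient [sin t / (1 - cos t)] tends to infinity.  A further eigenvalue [0]
    makes the supremum of the norms of [I - T^(n k)] equal to [1] rather than
    merely at most [1]. *)

(** * Operator norms *)

(** A uniform bound makes the supremum defining [op_norm] finite; only then do
    its upper-bound properties pass from the extended reals to its real part,
    which is why both conclusions need the same hypotheses. *)
Lemma op_norm_bounds {X : NormedModule C_AbsRing} (T : X -> X) (M : R) :
  0 <= M -> (forall x, norm (T x) <= M * norm x) ->
  op_norm T <= M /\ forall x, norm x <= 1 -> norm (T x) <= op_norm T.
Proof.
  intros hM hT. unfold op_norm.
  set (E := fun r => exists x : X, norm x <= 1 /\ r = norm (T x)).
  destruct (Lub_Rbar_correct E) as [hub hleast].
  assert (hE : is_ub_Rbar E (Finite M)).
  { intros r [x [hx ->]]. simpl.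
    assert (h := hT x). assert (h0 := norm_ge_0 x). nra. }
  assert (hup := hleast _ hE).
  assert (h0 : E (norm (T zero))).
  { exists zero. split; [rewrite norm_zero; lra | reflexivity]. }
  assert (hlow := hub _ h0).
  destruct (Lub_Rbar E) as [l| |]; simpl in *; try contradiction.
  split; [exact hup|].
  intros x hx. apply (hub (norm (T x))). exists x. split; [exact hx|reflexivity].
Qed.

(** * Diagonal operators *)

Definition bounded (a : nat -> C) : Prop := exists M, forall i, Cmod (a i) <= M.

Lemma square_summable_diag (a u : nat -> C) :
  bounded a -> square_summable u -> square_summable (fun i => (a i * u i)%C).
Proof.
  intros [M hM] hu. unfold square_summable.
  apply (ex_series_le (K := R_AbsRing) (V := R_CompleteNormedModule)) with
    (fun i => M ^ 2 * Cmod (u i) ^ 2).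
  - intros i. change (Rabs (Cmod (a i * u i)%C ^ 2) <= M ^ 2 * Cmod (u i) ^ 2).
    rewrite Rabs_pos_eq by apply pow2_ge_0.
    rewrite Cmod_mult, Rpow_mult_distr.
    apply Rmult_le_compat_r; [apply pow2_ge_0|].
    apply pow_incr. split; [apply Cmod_ge_0 | apply hM].
  - exact (ex_series_scal (V := R_NormedModule) (M ^ 2) _ hu).
Qed.

Definition diag (a : nat -> C) (ha : bounded a) (x : l2) : l2 :=
  exist _ _ (square_summable_diag a x ha (l2_summable x)).

Lemma diag_norm_le (a : nat -> C) (ha : bounded a) (M : R) (x : l2) :
  0 <= M -> (forall i, Cmod (a i) <= M) -> norm (diag a ha x) <= M * norm x.
Proof.
  intros hM0 hM. change (l2_norm (diag a ha x) <= M * l2_norm x).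
  apply Rsqr_incr_0;
    [|apply l2_norm_ge_0|apply Rmult_le_pos; [exact hM0|apply l2_norm_ge_0]].
  rewrite !Rsqr_pow2, Rpow_mult_distr, !l2_norm_sqr, <- Series_scal_l.
  apply Series_le.
  - intros i. split; [apply pow2_ge_0|]. cbn [diag l2_seq proj1_sig].
    rewrite Cmod_mult, Rpow_mult_distr.
    apply Rmult_le_compat_r; [apply pow2_ge_0|].
    apply pow_incr. split; [apply Cmod_ge_0 | apply hM].
  - exact (ex_series_scal (V := R_NormedModule) (M ^ 2) _ (l2_summable x)).
Qed.

Lemma bounded_pos (a : nat -> C) :
  bounded a -> exists M, 0 < M /\ forall i, Cmod (a i) <= M.
Proof.
  intros [M hM]. exists (M + 1).
  split; [|intros i; assert (h := hM i); lra].
  assert (h := hM O). assert (h0 := Cmod_ge_0 (a O)). lra.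
Qed.

Lemma diag_linear (a : nat -> C) (ha : bounded a) : is_linear (diag a ha).
Proof.
  split.
  - intros x y. apply l2_ext. intros i. apply Cmult_plus_distr_l.
  - intros c x. apply l2_ext. intros i.
    change (a i * (c * l2_seq x i) = c * (a i * l2_seq x i))%C. ring.
  - destruct (bounded_pos a ha) as [M [hM0 hM]]. exists M. split; [exact hM0|].
    intros x. apply diag_norm_le; [lra|exact hM].
Qed.

Lemma diag_adjoint (a : nat -> C) (ha : bounded a)
  (hb : bounded (fun i => Cconj (a i))) :
  is_adjoint (diag a ha) (diag (fun i => Cconj (a i)) hb).
Proof.
  split; [apply diag_linear|]. intros x y.
  assert (E : forall i, (diag a ha x i * Cconj (y i))%C =
                (x i * Cconj (diag (fun i => Cconj (a i)) hb y i))%C).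
  { intros i. cbn [diag l2_seq proj1_sig]. rewrite Cmult_conj, Cconj_conj. ring. }
  unfold l2_inner.
  f_equal; apply Series_ext; intros i; rewrite E; reflexivity.
Qed.

Lemma diag_normal (a : nat -> C) (ha : bounded a) : normal (diag a ha).
Proof.
  split; [apply diag_linear|].
  assert (hb : bounded (fun i => Cconj (a i))).
  { destruct ha as [M hM]. exists M. intros i. rewrite Cmod_conj. apply hM. }
  exists (diag _ hb). split; [apply diag_adjoint|].
  intros x. apply l2_ext. intros i.
  change (Cconj (a i) * (a i * x i) = a i * (Cconj (a i) * x i))%C. ring.
Qed.

(** Stated coordinatewise, since this form needs no proof that the sequence of
    powers is bounded. *)
Lemma diag_op_pow (a : nat -> C) (ha : bounded a) (n : nat) (x : l2) (i : nat) :
  l2_seq (op_pow (diag a ha) n x) i = (a i ^ n * x i)%C.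
Proof.
  induction n as [|n IH].
  - change (x i = 1 * x i)%C. ring.
  - change (a i * l2_seq (op_pow (diag a ha) n x) i = a i ^ S n * x i)%C.
    rewrite IH, Cpow_S. ring.
Qed.

(** * Basis vectors *)

Definition basis_seq (i : nat) : nat -> C :=
  fun k => if Nat.eq_dec k i then RtoC 1 else RtoC 0.

Lemma basis_is_series (i : nat) : is_series (fun k => Cmod (basis_seq i k) ^ 2) 1.
Proof.
  assert (Hlow : forall m, (m < i)%nat ->
            sum_n (fun k => Cmod (basis_seq i k) ^ 2) m = 0).
  { intros m hm. rewrite (sum_n_ext_loc _ (fun _ => 0)).
    - rewrite sum_n_const. apply Rmult_0_r.
    - intros k hk. unfold basis_seq. destruct (Nat.eq_dec k i); [lia|].
      rewrite Cmod_0. apply pow_i. lia. }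
  assert (H : forall m, (i <= m)%nat ->
            sum_n (fun k => Cmod (basis_seq i k) ^ 2) m = 1).
  { intros m hm. induction hm as [|m hm IH].
    - assert (E : Cmod (basis_seq i i) ^ 2 = 1).
      { unfold basis_seq. destruct (Nat.eq_dec i i); [|lia].
        rewrite Cmod_1. ring. }
      destruct i as [|i].
      + rewrite sum_O. exact E.
      + rewrite sum_Sn, Hlow, E by lia. apply Rplus_0_l.
    - rewrite sum_Sn, IH. unfold basis_seq.
      destruct (Nat.eq_dec (S m) i); [lia|].
      rewrite Cmod_0. change (1 + 0 ^ 2 = 1 :> R). ring. }
  change (is_lim_seq (sum_n (fun k => Cmod (basis_seq i k) ^ 2)) 1).
  apply is_lim_seq_ext_loc with (fun _ => 1); [|apply is_lim_seq_const].
  exists i. intros m hm. symmetry. apply H, hm.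
Qed.

Definition basis (i : nat) : l2 :=
  exist _ (basis_seq i) (ex_intro _ 1 (basis_is_series i)).

Lemma basis_norm (i : nat) : norm (basis i) = 1.
Proof.
  change (sqrt (Series (fun k => Cmod (basis_seq i k) ^ 2)) = 1).
  rewrite (is_series_unique _ _ (basis_is_series i)). apply sqrt_1.
Qed.

Lemma diag_basis (a : nat -> C) (ha : bounded a) (i : nat) :
  diag a ha (basis i) = scal (a i) (basis i).
Proof.
  apply l2_ext. intros k. change (a k * basis_seq i k = a i * basis_seq i k)%C.
  unfold basis_seq. destruct (Nat.eq_dec k i) as [->|]; ring.
Qed.

Lemma norm_scal_basis (c : C) (i : nat) : norm (scal c (basis i)) = Cmod c.
Proof.
  change (l2_norm (l2_scal c (basis i)) = Cmod c).
  rewrite l2_norm_scal. change (Cmod c * norm (basis i) = Cmod c).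
  rewrite basis_norm. ring.
Qed.

Lemma diag_op_norm_ge (a : nat -> C) (ha : bounded a) (i : nat) :
  Cmod (a i) <= op_norm (diag a ha).
Proof.
  destruct (bounded_pos a ha) as [M [hM0 hM]].
  rewrite <- (norm_scal_basis (a i) i), <- (diag_basis a ha).
  apply (op_norm_bounds (diag a ha) M).
  - lra.
  - intros x. apply diag_norm_le; [lra|exact hM].
  - rewrite basis_norm. lra.
Qed.

Lemma diag_op_norm_le (a : nat -> C) (ha : bounded a) (M : R) :
  (forall i, Cmod (a i) <= M) -> op_norm (diag a ha) <= M.
Proof.
  intros hM.
  assert (hM0 : 0 <= M) by exact (Rle_trans _ _ _ (Cmod_ge_0 (a O)) (hM O)).
  apply (op_norm_bounds (diag a ha) M); [exact hM0|].
  intros x. apply diag_norm_le; assumption.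
Qed.

(** * Spectrum of a diagonal operator *)

Lemma inv_away (z w : C) (eps : R) :
  0 < eps -> eps <= Cmod (z - w) -> (z - w)%C <> 0.
Proof. intros h h' E. rewrite E, Cmod_0 in h'. lra. Qed.

Lemma bounded_resolvent (a : nat -> C) (z : C) (eps : R) :
  0 < eps -> (forall i, eps <= Cmod (z - a i)) ->
  bounded (fun i => / (z - a i))%C.
Proof.
  intros h H. exists (/ eps). intros i.
  rewrite Cmod_inv by exact (inv_away _ _ _ h (H i)).
  apply Rinv_le_contravar; [exact h | apply H].
Qed.

Lemma diag_resolvent (a : nat -> C) (ha : bounded a) (z : C) (eps : R)
  (hb : bounded (fun i => / (z - a i))%C) :
  0 < eps -> (forall i, eps <= Cmod (z - a i)) ->
  is_resolvent (diag a ha) z (diag _ hb).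
Proof.
  intros h H.
  split; [apply diag_linear|].
  split; intros x; apply l2_ext; intros i; assert (hz := inv_away _ _ _ h (H i)).
  - change (/ (z - a i) * (z * l2_seq x i + RtoC (-1) * (a i * l2_seq x i))
            = l2_seq x i)%C.
    field. exact hz.
  - change (z * (/ (z - a i) * l2_seq x i)
            + RtoC (-1) * (a i * (/ (z - a i) * l2_seq x i)) = l2_seq x i)%C.
    field. exact hz.
Qed.

(** If the entries stay away from [z], inverting [z - a i] entrywise gives a
    bounded resolvent.  If some entries approach [z], the corresponding basis
    vectors are almost annihilated by [z - T], which no bounded inverse
    allows. *)
Lemma diag_spectrum (a : nat -> C) (ha : bounded a) (z : C) :
  spectrum (diag a ha) z <->
  forall eps, 0 < eps -> exists i, Cmod (z - a i) < eps.
Proof.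
  split.
  - intros hz eps h. apply NNPP. intros hno. apply hz.
    assert (H : forall i, eps <= Cmod (z - a i)).
    { intros i. apply Rnot_lt_le. intros hi. apply hno. exists i. exact hi. }
    exists (diag _ (bounded_resolvent a z eps h H)).
    exact (diag_resolvent a ha z eps _ h H).
  - intros H [S [hS [hSl _]]].
    destruct (linear_norm _ hS) as [M [hM0 hM]].
    destruct (H (/ M) (Rinv_0_lt_compat _ hM0)) as [i hi].
    assert (E : minus (scal z (basis i)) (diag a ha (basis i)) =
                scal (z - a i)%C (basis i)).
    { apply l2_ext. intros k.
      change (z * basis_seq i k + RtoC (-1) * (a k * basis_seq i k)
              = (z - a i) * basis_seq i k)%C.
      unfold basis_seq. destruct (Nat.eq_dec k i) as [->|]; ring. }
    assert (h : S (scal (z - a i)%C (basis i)) = basis i)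
      by (rewrite <- E; exact (hSl (basis i))).
    assert (hn := hM (scal (z - a i)%C (basis i))).
    rewrite h, norm_scal_basis, basis_norm in hn.
    apply (Rmult_lt_compat_l M) in hi; [|exact hM0].
    rewrite Rinv_r in hi by lra. lra.
Qed.

(** * Points in polar form *)

Definition polar (r t : R) : C := (r * cos t, r * sin t).

Lemma Cmod_polar (r t : R) : 0 <= r -> Cmod (polar r t) = r.
Proof.
  intros h. unfold Cmod, polar. simpl fst; simpl snd.
  replace ((r * cos t) ^ 2 + (r * sin t) ^ 2)
    with (r ^ 2 * (Rsqr (sin t) + Rsqr (cos t))) by (unfold Rsqr; ring).
  rewrite sin2_cos2, Rmult_1_r. apply sqrt_pow2, h.
Qed.

Lemma polar_pow (r t : R) (n : nat) :
  (polar r t ^ n)%C = polar (r ^ n) (INR n * t).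
Proof.
  induction n as [|n IH].
  - unfold polar. simpl. rewrite Rmult_0_l, cos_0, sin_0.
    unfold RtoC. f_equal; ring.
  - rewrite Cpow_S, IH, S_INR.
    replace ((INR n + 1) * t) with (t + INR n * t) by ring.
    unfold polar, Cmult. rewrite cos_plus, sin_plus. simpl. f_equal; ring.
Qed.

(** The square of the left-hand side is [1 - r (2 cos t - r)], and
    [2 cos t >= 1 >= r]. *)
Lemma Cmod_one_minus_polar_le (r t : R) :
  0 <= r <= 1 -> 1 / 2 <= cos t -> Cmod (1 - polar r t) <= 1.
Proof.
  intros hr hc. unfold Cmod.
  apply Rle_trans with (sqrt 1); [apply sqrt_le_1_alt|rewrite sqrt_1; lra].
  unfold polar. simpl.
  assert (E := sin2_cos2 t). unfold Rsqr in E.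
  assert (E' : (r * sin t) * (r * sin t) =
               r * r * (1 - cos t * cos t)) by (rewrite <- E; ring).
  nra.
Qed.

(** This is [(1 + e^(2 i t)) / 2], on the circle with diameter from [0] to
    [1]. *)
Definition circle_point (t : R) : C := polar (cos t) t.

Lemma Cmod_one_minus_circle_point (t : R) :
  0 <= sin t -> Cmod (1 - circle_point t) = sin t.
Proof.
  intros h. unfold Cmod, circle_point, polar.
  apply eq_trans with (2 := sqrt_pow2 (sin t) h). f_equal. simpl.
  assert (E := sin2_cos2 t). unfold Rsqr in E.
  replace (1 + - (cos t * cos t)) with (sin t * sin t) by lra.
  transitivity (sin t * sin t * (sin t * sin t + cos t * cos t));
    [ring | rewrite E; ring].
Qed.

(** * The eigenvalues attached to a chain *)

Definition angle (n : nat -> nat) (j : nat) : R := 2 * PI / INR (n (S j)).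

(** Indices of small quotients receive the entry [0], so that no subsequence
    has to be extracted.  The entry at index [0] ensures that [0] is always an
    eigenvalue. *)
Definition eigenvalue (n : nat -> nat) (i : nat) : C :=
  match i with
  | O => 0%C
  | S j => if Rle_dec 6 (quotient n j) then circle_point (angle n j) else 0%C
  end.

Lemma cos_ge_half t : 0 <= t <= PI / 3 -> 1 / 2 <= cos t.
Proof.
  intros h. rewrite <- cos_PI3. assert (h2 := PI_RGT_0).
  apply cos_decr_1; lra.
Qed.

Section Chain.

Context (n : nat -> nat) (hn : divisibility_chain n).

Lemma chain_pos k : 0 < INR (n k).
Proof. apply lt_0_INR. apply (proj1 hn). Qed.

Lemma chain_ge k : (S k <= n k)%nat.
Proof.
  induction k as [|k IH]; [apply (proj1 hn)|].
  assert (h := proj1 (proj2 hn) k). lia.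
Qed.

Lemma chain_le i j : (i <= j)%nat -> (n i <= n j)%nat.
Proof.
  intros h. induction h as [|j h IH]; [lia|].
  assert (h' := proj1 (proj2 hn) j). lia.
Qed.

Lemma chain_divide i j : (i <= j)%nat -> Nat.divide (n i) (n j).
Proof.
  intros h. induction h as [|j h IH]; [apply Nat.divide_refl|].
  apply Nat.divide_trans with (1 := IH). apply (proj2 (proj2 hn)).
Qed.

Lemma angle_pos j : 0 < angle n j.
Proof.
  apply Rdiv_lt_0_compat; [|apply chain_pos]. assert (h := PI_RGT_0). lra.
Qed.

Lemma angle_mult_le j : 6 <= quotient n j -> INR (n j) * angle n j <= PI / 3.
Proof.
  intros h. unfold quotient in h. unfold angle.
  assert (h0 := chain_pos j). assert (h1 := chain_pos (S j)).
  assert (h2 := PI_RGT_0).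
  apply Rmult_le_reg_r with (INR (n (S j))); [exact h1|].
  replace (INR (n j) * (2 * PI / INR (n (S j))) * INR (n (S j)))
    with (2 * PI * INR (n j)) by (field; lra).
  apply (Rmult_le_compat_r (INR (n j))) in h; [|lra].
  replace (INR (n (S j)) / INR (n j) * INR (n j)) with (INR (n (S j))) in h
    by (field; lra).
  nra.
Qed.

Lemma angle_le j : 6 <= quotient n j -> angle n j <= PI / 3.
Proof.
  intros h. assert (h1 := angle_mult_le j h). assert (h2 := angle_pos j).
  assert (h3 : 1 <= INR (n j)).
  { apply (le_INR 1). apply (proj1 hn). }
  nra.
Qed.

(** Up to index [j] the angle is at most [pi / 3] by the large quotient; beyond
    [j] it is a multiple of [2 pi] by divisibility. *)
Lemma cos_chain_angle j k :
  6 <= quotient n j -> 1 / 2 <= cos (INR (n k) * angle n j).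
Proof.
  intros h. assert (h2 := angle_pos j).
  destruct (Nat.le_gt_cases k j) as [hk|hk].
  - apply cos_ge_half. split.
    + assert (h0 := chain_pos k). nra.
    + apply Rle_trans with (2 := angle_mult_le j h).
      apply Rmult_le_compat_r; [lra|]. apply le_INR, chain_le, hk.
  - destruct (chain_divide (S j) k hk) as [q hq].
    rewrite hq, mult_INR. unfold angle.
    replace (INR q * INR (n (S j)) * (2 * PI / INR (n (S j))))
      with (0 + 2 * INR q * PI) by (field; assert (h1 := chain_pos (S j)); lra).
    rewrite cos_period, cos_0. lra.
Qed.

Lemma angle_trig j : 6 <= quotient n j ->
  1 / 2 <= cos (angle n j) < 1 /\ 0 < sin (angle n j) < angle n j.
Proof.
  intros h. assert (h1 := angle_pos j). assert (h2 := angle_le j h).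
  assert (h3 := PI_RGT_0).
  split; split.
  - apply cos_ge_half. lra.
  - rewrite <- cos_0. apply cos_decreasing_1; lra.
  - apply sin_gt_0; lra.
  - apply sin_lt_x. exact h1.
Qed.

Lemma angle_small (eps : R) : 0 < eps ->
  exists N, forall j, (N <= j)%nat -> angle n j < eps.
Proof.
  intros h. destruct (INR_unbounded (2 * PI / eps)) as [N hN].
  exists N. intros j hj. unfold angle.
  assert (h1 : INR N < INR (n (S j))).
  { apply lt_INR. assert (h2 := chain_ge (S j)). lia. }
  assert (h3 := chain_pos (S j)).
  apply Rmult_lt_reg_r with (INR (n (S j))); [exact h3|].
  replace (2 * PI / INR (n (S j)) * INR (n (S j)))
    with (eps * (2 * PI / eps)) by (field; lra).
  apply Rmult_lt_compat_l; lra.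
Qed.

Lemma Cmod_eigenvalue_lt i : Cmod (eigenvalue n i) < 1.
Proof.
  destruct i as [|j]; simpl; [rewrite Cmod_0; lra|].
  destruct (Rle_dec 6 (quotient n j)) as [h|h]; [|rewrite Cmod_0; lra].
  destruct (angle_trig j h) as [hc _].
  unfold circle_point. rewrite Cmod_polar; lra.
Qed.

Lemma bounded_eigenvalue : bounded (eigenvalue n).
Proof. exists 1. intros i. apply Rlt_le, Cmod_eigenvalue_lt. Qed.

Lemma Cmod_one_minus_eigenvalue_pow i k :
  Cmod (1 - eigenvalue n i ^ n k) <= 1.
Proof.
  assert (H0 : Cmod (1 - 0 ^ n k) <= 1).
  { assert (h := proj1 hn k). destruct (n k) as [|m]; [lia|].
    rewrite Cpow_S, Cmult_0_l. unfold Cminus. rewrite Copp_0, Cplus_0_r, Cmod_1.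
    lra. }
  destruct i as [|j]; simpl; [exact H0|].
  destruct (Rle_dec 6 (quotient n j)) as [h|h]; [|exact H0].
  destruct (angle_trig j h) as [hc _].
  unfold circle_point. rewrite polar_pow.
  apply Cmod_one_minus_polar_le; [|apply cos_chain_angle, h].
  split; [apply pow_le; lra|].
  rewrite <- (pow1 (n k)). apply pow_incr. lra.
Qed.

(** * The operator attached to a chain *)

Definition chain_operator : l2 -> l2 := diag (eigenvalue n) bounded_eigenvalue.

Lemma chain_operator_contraction : contraction chain_operator.
Proof.
  split; [apply diag_linear|]. apply diag_op_norm_le.
  intros i. apply Rlt_le, Cmod_eigenvalue_lt.
Qed.

(** The entry [0] of the operator is an entry [1] of [I - T^(n k)], so every
    norm in the supremum is at least [1]. *)
Lemma chain_operator_sup :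
  is_lub
    (fun r => exists k : nat,
       r = op_norm (fun x => minus x (op_pow chain_operator (n k) x))) 1.
Proof.
  assert (hb : forall k, bounded (fun i => 1 - eigenvalue n i ^ n k)%C).
  { intros k. exists 1. intros i. apply Cmod_one_minus_eigenvalue_pow. }
  assert (E : forall k,
    op_norm (fun x => minus x (op_pow chain_operator (n k) x)) =
    op_norm (diag _ (hb k))).
  { intros k. f_equal. apply functional_extensionality.
    intros x. apply l2_ext. intros i.
    change (l2_seq x i + RtoC (-1) * l2_seq (op_pow chain_operator (n k) x) i
            = (1 - eigenvalue n i ^ n k) * l2_seq x i)%C.
    unfold chain_operator. rewrite diag_op_pow. ring. }
  split.
  - intros r [k ->]. rewrite E. apply diag_op_norm_le.
    intros i. apply Cmod_one_minus_eigenvalue_pow.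
  - intros b hub.
    apply Rle_trans with (op_norm (diag _ (hb O))).
    + apply Rle_trans with (2 := diag_op_norm_ge _ (hb O) O).
      assert (h := proj1 hn O). simpl. destruct (n O) as [|m]; [lia|].
      rewrite Cpow_S, Cmult_0_l. unfold Cminus.
      rewrite Copp_0, Cplus_0_r, Cmod_1. lra.
    + apply hub. exists O. symmetry. apply E.
Qed.

End Chain.

Lemma finite_lower_bound (f : nat -> R) (N : nat) :
  (forall i, 0 < f i) -> exists eps, 0 < eps /\ forall i, (i < N)%nat -> eps <= f i.
Proof.
  intros h. induction N as [|N [eps [he IH]]].
  - exists 1. split; [lra|]. intros i hi. lia.
  - exists (Rmin eps (f N)). split; [apply Rmin_pos; auto|].
    intros i hi. destruct (Nat.eq_dec i N) as [->|hne]; [apply Rmin_r|].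
    apply Rle_trans with (1 := Rmin_l _ _). apply IH. lia.
Qed.

Section LargeQuotients.

Context (n : nat -> nat) (hn : divisibility_chain n)
  (hq : forall N : nat, exists j : nat, (N <= j)%nat /\ 6 <= quotient n j).

(** The entries lie in the open disc and those of large index are [0] or close
    to [1], so that a unimodular number other than [1] is at positive distance
    from them: finitely many entries, [0], and a neighbourhood of [1] are each
    at positive distance. *)
Lemma chain_operator_spectrum (z : C) :
  (spectrum (chain_operator n hn) z /\ Cmod z = 1) <-> z = RtoC 1.
Proof.
  unfold chain_operator. rewrite diag_spectrum. split.
  - intros [hz hz1]. apply NNPP. intros hne.
    set (d := Cmod (z - 1)).
    assert (hd : 0 < d) by (apply Cmod_gt_0, Cminus_eq_contra, hne).
    destruct (angle_small n hn (d / 2)) as [N hN]; [lra|].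
    destruct (finite_lower_bound (fun i => Cmod (z - eigenvalue n i)) (S N))
      as [eps [he H]].
    { intros i. assert (h := Cmod_eigenvalue_lt n hn i).
      apply Cmod_gt_0, Cminus_eq_contra. intros E. rewrite <- E in h. lra. }
    assert (hm : 0 < Rmin eps (Rmin (d / 2) 1)).
    { apply Rmin_pos; [exact he|]. apply Rmin_pos; lra. }
    destruct (hz _ hm) as [i hi].
    assert (h1 := Rmin_l eps (Rmin (d / 2) 1)).
    assert (h2 := Rmin_r eps (Rmin (d / 2) 1)).
    assert (h3 := Rmin_l (d / 2) 1). assert (h4 := Rmin_r (d / 2) 1).
    destruct (Nat.lt_ge_cases i (S N)) as [hlt|hge].
    { assert (h := H i hlt). simpl in h. lra. }
    destruct i as [|j]; [lia|]. simpl in hi.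
    assert (H0 : Cmod (z - 0) = 1).
    { rewrite <- hz1. f_equal. ring. }
    destruct (Rle_dec 6 (quotient n j)) as [h|h]; [|lra].
    destruct (angle_trig n hn j h) as [_ hs].
    assert (ha := hN j ltac:(lia)).
    assert (hp := Cmod_one_minus_circle_point (angle n j) ltac:(lra)).
    assert (htri : d <= Cmod (z - circle_point (angle n j))
                        + Cmod (1 - circle_point (angle n j))).
    { rewrite <- (Cmod_opp (1 - _)). unfold d.
      replace (z - 1)%C with ((z - circle_point (angle n j)) +
        - (1 - circle_point (angle n j)))%C by ring.
      apply Cmod_triangle. }
    lra.
  - intros ->. split; [|apply Cmod_1].
    intros eps he. destruct (angle_small n hn eps he) as [N hN].
    destruct (hq N) as [j [hj h]]. exists (S j). simpl.
    destruct (Rle_dec 6 (quotient n j)) as [h'|h']; [|contradiction].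
    destruct (angle_trig n hn j h) as [_ hs].
    rewrite Cmod_one_minus_circle_point by lra.
    assert (ha := hN j hj). lra.
Qed.

(** The resolvent is tested at a point [z] on the ray through the eigenvalue
    [w = cos t e^(i t)], so that [|z - w|] is comparable with [1 - cos t].  The
    Ritt estimate would then bound [sin t / (1 - cos t)], whereas
    [(1 - cos t) (1 + cos t) = sin t ^ 2] makes it of order [1 / t]. *)
Lemma chain_operator_not_ritt : ~ ritt (chain_operator n hn).
Proof.
  intros [_ [_ [M hM]]].
  (* A positive bound is needed to choose how small the angle should be. *)
  set (M' := Rmax M 1).
  assert (hM1 : M <= M') by apply Rmax_l. assert (hM0 : 1 <= M') by apply Rmax_r.
  destruct (angle_small n hn (/ (2 * M'))) as [N hN].
  { apply Rinv_0_lt_compat. lra. }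
  destruct (hq N) as [j [hj h]]. assert (ha := hN j hj).
  destruct (angle_trig n hn j h) as [hc hs].
  set (t := angle n j) in *.
  (* On the ray of [w] and as far outside the unit circle as [w] is inside:
     [|z| - 1] and [1 - |w|] are both [1 - cos t]. *)
  set (z := polar (2 - cos t) t).
  assert (hz : Cmod z = 2 - cos t) by (apply Cmod_polar; lra).
  assert (haway : forall i, 1 - cos t <= Cmod (z - eigenvalue n i)).
  { intros i. assert (hi := Cmod_eigenvalue_lt n hn i).
    assert (htri := Cmod_triangle (z - eigenvalue n i) (eigenvalue n i)).
    replace (z - eigenvalue n i + eigenvalue n i)%C with z in htri by ring.
    lra. }
  assert (hpos : 0 < 1 - cos t) by lra.
  assert (hb := bounded_resolvent (eigenvalue n) z _ hpos haway).
  assert (hR := hM z _ ltac:(lra)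
    (diag_resolvent _ (bounded_eigenvalue n hn) z _ hb hpos haway)).
  assert (hS := diag_op_norm_ge _ hb (S j)). simpl in hS.
  destruct (Rle_dec 6 (quotient n j)) as [h'|h']; [|contradiction].
  fold t in hS.
  assert (E : (z - circle_point t)%C = polar (2 * (1 - cos t)) t).
  { unfold z, circle_point, polar, Cminus, Cplus, Copp. simpl. f_equal; ring. }
  rewrite E, Cmod_inv, Cmod_polar in hS;
    [|lra|intros E0; apply (f_equal Cmod) in E0;
          rewrite Cmod_0, Cmod_polar in E0; lra].
  (* [|z - 1|] is bounded below by the imaginary part of [z]. *)
  assert (hIm : sin t <= Cmod (z - 1)).
  { assert (h1 := Rle_trans _ _ _ (Rmax_r _ _) (Rmax_Cmod (z - 1)%C)).
    change (Rabs ((2 - cos t) * sin t + - 0) <= Cmod (z - 1)) in h1.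
    assert (h2 := Rle_abs ((2 - cos t) * sin t + - 0)). nra. }
  assert (hle : sin t * / (2 * (1 - cos t)) <= M').
  { apply Rle_trans with (2 := hM1), Rle_trans with (2 := hR).
    apply Rmult_le_compat; [lra| |exact hIm|exact hS].
    apply Rlt_le, Rinv_0_lt_compat. lra. }
  apply (Rmult_le_compat_r (2 * (1 - cos t))) in hle; [|lra].
  rewrite Rmult_assoc, Rinv_l, Rmult_1_r in hle by lra.
  assert (hsc := sin2_cos2 t). unfold Rsqr in hsc.
  assert (hta : 2 * M' * sin t < 1).
  { apply Rmult_lt_reg_l with (/ (2 * M')); [apply Rinv_0_lt_compat; lra|].
    rewrite <- Rmult_assoc, Rinv_l by lra. lra. }
  assert (hkey : sin t * (1 + cos t) <= sin t * (2 * M' * sin t)) by nra.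
  apply Rmult_le_reg_l in hkey; lra.
Qed.

End LargeQuotients.

(** * Unbounded quotients *)

Lemma unbounded_quotients_frequently (n : nat -> nat) (c : R) :
  (forall M : R, exists j : nat, M < quotient n j) ->
  forall N : nat, exists j : nat, (N <= j)%nat /\ c <= quotient n j.
Proof.
  intros h N.
  assert (H : exists M, c <= M /\ forall j, (j < N)%nat -> quotient n j <= M).
  { induction N as [|N [M [hM IH]]].
    - exists c. split; [lra|]. intros j hj. lia.
    - exists (Rmax M (quotient n N)).
      assert (h1 := Rmax_l M (quotient n N)).
      assert (h2 := Rmax_r M (quotient n N)).
      split; [lra|]. intros j hj.
      destruct (Nat.eq_dec j N) as [->|hne]; [exact h2|].
      assert (h3 := IH j ltac:(lia)). lra. }
  destruct H as [M [hM H]]. destruct (h M) as [j hj]. exists j. split; [|lra].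
  destruct (Nat.le_gt_cases N j) as [hle|hgt]; [exact hle|].
  assert (h3 := H j hgt). lra.
Qed.

Theorem proposition7p3 :
  (forall n : nat -> nat,
     divisibility_chain n ->
     (forall N : nat, exists j : nat, (N <= j)%nat /\ 6 <= quotient n j) ->
     exists T : l2 -> l2,
       normal T /\
       contraction T /\
       (forall z : C, (spectrum T z /\ Cmod z = 1) <-> z = RtoC 1) /\
       is_lub
         (fun r => exists k : nat,
            r = op_norm (fun x => minus x (op_pow T (n k) x))) 1 /\
       ~ ritt T) /\
  (forall n : nat -> nat,
     divisibility_chain n ->
     (forall M : R, exists j : nat, M < quotient n j) ->
     exists T : l2 -> l2,
       normal T /\
       contraction T /\
       (forall z : C, (spectrum T z /\ Cmod z = 1) <-> z = RtoC 1) /\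
       is_lub
         (fun r => exists k : nat,
            r = op_norm (fun x => minus x (op_pow T (n k) x))) 1 /\
       ~ ritt T).
Proof.
  assert (main : forall n : nat -> nat,
     divisibility_chain n ->
     (forall N : nat, exists j : nat, (N <= j)%nat /\ 6 <= quotient n j) ->
     exists T : l2 -> l2,
       normal T /\
       contraction T /\
       (forall z : C, (spectrum T z /\ Cmod z = 1) <-> z = RtoC 1) /\
       is_lub
         (fun r => exists k : nat,
            r = op_norm (fun x => minus x (op_pow T (n k) x))) 1 /\
       ~ ritt T).
  { intros n hn hq. exists (chain_operator n hn).
    split; [apply diag_normal|].
    split; [apply chain_operator_contraction|].
    split; [exact (chain_operator_spectrum n hn hq)|].
    split; [apply chain_operator_sup|].
    exact (chain_operator_not_ritt n hn hq). }
  split; [exact main|].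
  intros n hn hu. apply main; [exact hn|].
  exact (unbounded_quotients_frequently n 6 hu).
Qed.
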